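(* Let $I\subset[0,\infty)$ be an interval and let $f:I\to\mathbb{R}$ be a differentiable function on $I^{\circ}$, the interior of $I$, such that $f'\in L[a,b]$, where $a,b\in I$ with $a<b$. Let $p,q>1$ with $\frac1p+\frac1q=1$, and let $\alpha>0$. If $|f'|^{q}$ is $s$-convex on $[a,b]$ for some fixed $s\in(0,1]$ and $x\in[a,b]$, then $$\left|\frac{(x-a)^{\alpha}f(a)+(b-x)^{\alpha}f(b)}{b-a}-\frac{\Gamma(\alpha+1)}{b-a}\left[J_{x^{-}}^{\alpha}f(a)+J_{x^{+}}^{\alpha}f(b)\right]\right|$$ $$\le\left(\frac{\Gamma(1+p)\,\Gamma\left(1+\frac1\alpha\right)}{\Gamma\left(1+p+\frac1\alpha\right)}\right)^{\frac1p}\left\{\frac{(x-a)^{\alpha+1}}{b-a}\left(\frac{|f'(x)|^{q}+|f'(a)|^{q}}{s+1}\right)^{\frac1q}+\frac{(b-x)^{\alpha+1}}{b-a}\left(\frac{|f'(x)|^{q}+|f'(b)|^{q}}{s+1}\right)^{\frac1q}\right\}.$$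
   Context: $\Gamma(\alpha)=\int_0^\infty e^{-u}u^{\alpha-1}\,du$ is the Euler Gamma function. The Riemann-Liouville fractional integrals of order $\alpha>0$ are $J_{c^{+}}^{\alpha}f(y)=\frac{1}{\Gamma(\alpha)}\int_{c}^{y}(y-t)^{\alpha-1}f(t)\,dt$ for $y>c$ and $J_{d^{-}}^{\alpha}f(y)=\frac{1}{\Gamma(\alpha)}\int_{y}^{d}(t-y)^{\alpha-1}f(t)\,dt$ for $y<d$. Thus $$J_{x^{-}}^{\alpha}f(a)=\frac{1}{\Gamma(\alpha)}\int_{a}^{x}(t-a)^{\alpha-1}f(t)\,dt,\qquad J_{x^{+}}^{\alpha}f(b)=\frac{1}{\Gamma(\alpha)}\int_{x}^{b}(b-t)^{\alpha-1}f(t)\,dt,$$ where the first is $0$ if $x=a$ and the second is $0$ if $x=b$. $f'\in L[a,b]$ means that $f'$ exists on $[a,b]$ (as a one-sided derivative at $a$ or $b$ if that point is an endpoint of $I$) and is Lebesgue integrable on $[a,b]$. A function $g:[a,b]\to\mathbb{R}$, with $[a,b]\subset[0,\infty)$, is $s$-convex (in the second sense) on $[a,b]$ if $g(\lambda u+\mu v)\le\lambda^{s}g(u)+\mu^{s}g(v)$ for all $u,v\in[a,b]$ and all $\lambda,\mu\ge0$ with $\lambda+\mu=1$. *)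

(* Defs.v *)
From HB Require Import structures.
From mathcomp Require Import all_boot all_order all_algebra.
From mathcomp Require Import all_classical all_reals all_analysis.
Set Implicit Arguments.
Unset Strict Implicit.
Unset Printing Implicit Defensive.
Import Order.TTheory GRing.Theory Num.Theory.
Import numFieldNormedType.Exports.
Local Open Scope classical_set_scope.
Local Open Scope ring_scope.

Definition Gamma (R : realType) (alpha : R) : R :=
  \int[@lebesgue_measure R]_(u in `]0, +oo[) (expR (- u) * u `^ (alpha - 1)).

(* Riemann-Liouville integrals, as Lebesgue integrals. They vanish when the
   two endpoints coincide, because singletons are Lebesgue negligible. *)
Definition RL_right (R : realType) (c alpha : R) (f : R -> R) (y : R) : R :=
  (Gamma alpha)^-1 *
  \int[@lebesgue_measure R]_(t in `[c, y]) ((y - t) `^ (alpha - 1) * f t).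

Definition RL_left (R : realType) (d alpha : R) (f : R -> R) (y : R) : R :=
  (Gamma alpha)^-1 *
  \int[@lebesgue_measure R]_(t in `[y, d]) ((t - y) `^ (alpha - 1) * f t).

(* Derivative of the restriction of f to I: the usual derivative at an interior
   point of I, the one-sided derivative at an endpoint belonging to I. It only
   depends on the values of f on I. *)
Definition derivable_within (R : realType) (I : set R) (f : R -> R) (x : R) :
    Prop :=
  cvg ((f y - f x) / (y - x) @[y --> within I x^']).

Definition derive_within (R : realType) (I : set R) (f : R -> R) (x : R) : R :=
  lim ((f y - f x) / (y - x) @[y --> within I x^']).

Definition sconvex_on (R : realType) (s : R) (A : set R) (g : R -> R) : Prop :=
  forall u v lambda mu : R, A u -> A v -> 0 <= lambda -> 0 <= mu ->
    lambda + mu = 1 ->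
    g (lambda * u + mu * v) <= lambda `^ s * g u + mu `^ s * g v.

(* Main.v *)
Require Import Defs.
From HB Require Import structures.
From mathcomp Require Import all_boot all_order all_algebra.
From mathcomp Require Import ring lra.
From mathcomp Require Import all_classical all_reals all_analysis.
From mathcomp Require Import measurable_realfun.
Set Implicit Arguments.
Unset Strict Implicit.
Unset Printing Implicit Defensive.
Import Order.TTheory GRing.Theory Num.Theory.
Import numFieldNormedType.Exports.
Local Open Scope classical_set_scope.
Local Open Scope ring_scope.

(** Let [c] be one of the endpoints [a], [b], put [m = x - c] and
    [phi u = f (m * u + c)] for [u] in [[0, 1]]. An affine change of variable
    turns the half of the left-hand side attached to [c] into [|m|^alpha] times
    the mean of [phi 0 - phi u] against the probability density
    [alpha * u^(alpha - 1)], so that the theorem is a bound on that mean, used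
    once for [c = a] and once for [c = b] ([endpoint_deviation_bound]).

    By s-convexity, [|f' (m u + c)|^q <= u^s |f' x|^q + (1 - u)^s |f' c|^q].
    Hence [|phi'|] is dominated on [[0, 1]] by
    [k u = |m| (u^s |f' x|^q + (1 - u)^s |f' c|^q)^(1/q)], which is continuous on
    the open interval and bounded. This replaces the fundamental theorem of
    calculus for the possibly discontinuous [f']: if [K] is the primitive of [k]
    vanishing at [0], then [K + phi] and [K - phi] are nondecreasing, so that
    [|phi u - phi 0| <= K u] ([norm_increment_le_primitive]). Integrating this
    against the weight and exchanging the two integrals gives the upper bound
    [int_0^1 (1 - v^alpha) k v dv] ([weighted_deviation_le]); Tonelli's theorem
    does here the work of an integration by parts, and is indifferent to the
    singularity of the weight at [0] when [alpha < 1].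

    Hoelder's inequality then separates the two factors. The integral of [k^q]
    is [|m|^q (|f' x|^q + |f' c|^q) / (s + 1)], and the integral of
    [(1 - v^alpha)^p] is a Beta integral, whose expression by Gamma functions is
    [integral_powR_onem]. The facts about Gamma used here (finiteness,
    [Gamma (alpha + 1) = alpha * Gamma alpha], and the Beta formula) all come
    from one instance of Tonelli's theorem, [tonelli_epigraph], applied to
    well-chosen regions [T v < w] of the quadrant. *)

(** * Affine change of variable for the Lebesgue measure *)

Section lebesgue_integrals.
Context {R : realType}.
Notation mu := (@lebesgue_measure R).

Lemma measurable_affine (m c : R) :
  measurable_fun [set: measurableTypeR R]
    (fun u : measurableTypeR R => m * u + c : measurableTypeR R).
Proof.
by apply: measurable_funD => //; exact: measurable_funM.
Qed.

(** Lebesgue measure is determined by its values on the intervals [`]x, y]], and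
    the right-hand side is a measure in [A] with the right values there. *)
Lemma lebesgue_measure_affine (m c : R) (A : set R) : m != 0 -> measurable A ->
  mu A = (`|m|%:E * mu [set u | A (m * u + c)%R])%E.
Proof.
move=> m0 mA.
pose k : {nonneg R} := NngNum (normr_ge0 m).
pose aff := (fun u : measurableTypeR R => m * u + c : measurableTypeR R).
have maff : measurable_fun setT aff by exact: measurable_affine.
pose nu : {measure set (measurableTypeR R) -> \bar R} :=
  mscale k (pushforward mu aff).
transitivity (nu maff A); last by [].
apply: (@lebesgue_measure_unique R (nu maff) _ A mA) => _ [[x y]] /= xy <-.
rewrite /nu /mscale /= /pushforward /=.
(* The preimage of an interval keeps its orientation when [0 < m] and is
   reversed, with its closed end on the left, when [m < 0]. *)
have [mp|mn|] := ltgtP 0 m; last by move=> m00; rewrite -m00 eqxx in m0.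
- rewrite (_ : aff @^-1` _ = `](x - c) / m, (y - c) / m]%classic); last first.
    apply/seteqP; split => u /=; rewrite !in_itv /= /aff;
    by rewrite ltr_pdivrMr// ler_pdivlMr// ltrBlDr lerBrDr (mulrC u).
  rewrite !lebesgue_measure_itv /= !lte_fin ltr_pM2r ?invr_gt0// ltrD2r.
  case: ifPn => _; last by rewrite mule0.
  by rewrite gtr0_norm// -!EFinB -EFinM; congr EFin; field.
- rewrite (_ : aff @^-1` _ = `[(y - c) / m, (x - c) / m[%classic); last first.
    apply/seteqP; split => u /=; rewrite !in_itv /= /aff;
    by rewrite ler_ndivrMr// ltr_ndivlMr// ltrBlDr lerBrDr (mulrC u) andbC.
  rewrite !lebesgue_measure_itv /= !lte_fin ltr_nM2r ?invr_lt0// ltrD2r.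
  case: ifPn => _; last by rewrite mule0.
  by rewrite ltr0_norm// -!EFinB -EFinM; congr EFin; field.
Qed.

Lemma ge0_integral_affine (m c : R) (D : set R) (g : R -> \bar R) :
  m != 0 -> measurable D -> measurable_fun D g ->
  (forall t, D t -> (0 <= g t)%E) ->
  (\int[mu]_(t in D) g t =
   `|m|%:E * \int[mu]_(u in [set u | D (m * u + c)%R]) g (m * u + c)%R)%E.
Proof.
move=> m0 mD mg g0.
pose k : {nonneg R} := NngNum (normr_ge0 m).
pose aff := (fun u : measurableTypeR R => m * u + c : measurableTypeR R).
have maff : measurable_fun setT aff by exact: measurable_affine.
pose nu : {measure set (measurableTypeR R) -> \bar R} := pushforward mu aff.
rewrite (@eq_measure_integral _ _ _ _ (mscale k (nu maff))); last first.
  move=> A mA _; exact: lebesgue_measure_affine.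
rewrite ge0_integral_mscale//; congr (_ * _)%E.
rewrite ge0_integral_pushforward// => t /[!inE]; exact: g0.
Qed.

(** * Tonelli's theorem and two elementary integrals *)

(** Restricting [h] by zero to the region [T v < w] of [D1 * D2] reduces this to
    Tonelli's theorem on the plane. The inner domains are left as intersections;
    in each application both of them are intervals. *)
Lemma tonelli_epigraph (D1 D2 : set R) (T : R -> R) (h : R -> R -> R) :
  measurable D1 -> measurable D2 -> measurable_fun [set: R] T ->
  measurable_fun [set: R * R] (fun z => h z.1 z.2) ->
  (forall v w, D1 v -> D2 w -> T v < w -> 0 <= h v w) ->
  (\int[mu]_(v in D1) \int[mu]_(w in D2 `&` [set w | (T v < w)%R]) (h v w)%:E =
   \int[mu]_(w in D2) \int[mu]_(v in D1 `&` [set v | (T v < w)%R]) (h v w)%:E)%E.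
Proof.
move=> mD1 mD2 mT mh h0.
pose E := [set z : R * R | D1 z.1 /\ D2 z.2 /\ T z.1 < z.2].
pose H : R * R -> \bar R := (fun z => (h z.1 z.2)%:E) \_ E.
have mE : measurable E.
  have -> : E = (D1 `*` D2) `&` [set z | T z.1 < z.2].
    by apply/seteqP; split => z /= => [[? []]|[[]]].
  apply: measurableI; first exact: measurableX.
  have mlt : measurable_fun [set: R * R] (fun z => T z.1 < z.2).
    by apply: measurable_fun_ltr => //; exact: measurableT_comp.
  by have := mlt measurableT [set true] I; rewrite setTI.
have mH : measurable_fun setT H.
  apply/measurable_restrict => //; apply: measurable_funTS.
  exact/measurable_EFinP.
have H0 z : (0 <= H z)%E.
  rewrite /H patchE; case: ifPn => // /[!inE] -[? [? ?]].
  by rewrite lee_fin h0.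
have := @fubini_tonelli _ _ _ _ _ mu mu H mH H0.
congr (_ = _).
- rewrite [RHS]integral_mkcond; apply: eq_integral => v _.
  rewrite patchE; case: ifPn; [rewrite inE => Dv|rewrite notin_setE => Dv].
    rewrite [RHS]integral_mkcond; apply: eq_integral => w _.
    rewrite /H !patchE /=; congr (if _ then _ else _).
    by apply/idP/idP; rewrite !inE /E/= => -[].
  apply: integral0_eq => w _; rewrite /H patchE ifF//.
  by apply/negbTE; rewrite notin_setE /E /= => -[].
- rewrite [RHS]integral_mkcond; apply: eq_integral => w _.
  rewrite patchE; case: ifPn; [rewrite inE => Dw|rewrite notin_setE => Dw].
    rewrite [RHS]integral_mkcond; apply: eq_integral => v _.
    rewrite /H !patchE /=; congr (if _ then _ else _).
    by apply/idP/idP; rewrite !inE /E/= => -[]; tauto.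
  apply: integral0_eq => v _; rewrite /H patchE ifF//.
  by apply/negbTE; rewrite notin_setE /E /= => -[_ []].
Qed.

Lemma integral_expRN (v : R) :
  (\int[mu]_(w in `]v, +oo[) (expR (- w))%:E = (expR (- v))%:E)%E.
Proof.
rewrite integral_itv_obnd_cbnd; last first.
  apply: measurable_funTS; apply/measurable_EFinP.
  by apply: measurableT_comp => //; exact: measurableT_comp.
have dexp (x : R) : is_derive x 1 (fun w => - expR (- w)) (expR (- x)).
  apply: is_derive_eq.
  by rewrite mulrN1 opprK.
rewrite (@ge0_continuous_FTC2y _ _ (fun w => - expR (- w)) _ 0).
- by rewrite EFinN oppeK add0e.
- by move=> x _; exact: expR_ge0.
- apply: continuous_subspaceT => x.
  by apply: continuous_comp; [exact: opp_continuous|exact: continuous_expR].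
- by rewrite -oppr0; apply: cvgN; exact: cvgr_expR.
- by move=> x _; exact: ex_derive.
- apply: cvg_at_right_filter.
  have : {for v, continuous (fun w => - expR (- w))} by
    apply: differentiable_continuous; apply/derivable1_diffP; exact: ex_derive.
  exact.
- by move=> x _; rewrite derive1E; exact: derive_val.
Qed.

Lemma integral_powR_pos (r v w : R) : 0 < v -> v < w ->
  (\int[mu]_(t in `[v, w]) (r * t `^ (r - 1))%:E = (w `^ r - v `^ r)%:E)%E.
Proof.
move=> v0 vw.
have pos t : v <= t -> 0 < t by exact: lt_le_trans.
have cont (e t : R) : v <= t -> {for t, continuous (fun t => t `^ e)}.
  move=> /pos t0; apply: differentiable_continuous; apply/derivable1_diffP.
  by apply: derivable_powR; rewrite in_itv /= t0.
rewrite (@continuous_FTC2 _ _ (fun t => t `^ r)) ?EFinB//.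
- apply/continuous_in_subspaceT => t /[!inE] /= /[!in_itv] /= /andP[vt _].
  by apply: cvgM; [exact: cvg_cst|exact: cont].
- split.
  + move=> t /[!in_itv] /= /andP[/ltW vt _].
    by apply: derivable_powR; rewrite in_itv /= pos.
  + by apply: cvg_at_right_filter; exact: cont.
  + by apply: cvg_at_left_filter; apply: cont; exact: ltW.
- move=> t /[!in_itv] /= /andP[/ltW vt _].
  by apply: powR_derive1; rewrite in_itv /= pos.
Qed.

Lemma measurable_powR_weight (r : R) (D : set R) :
  measurable_fun D (fun t : R => (r * t `^ (r - 1))%:E).
Proof.
apply: measurable_funTS; apply/measurable_EFinP.
by apply: measurable_funM => //; exact: measurable_powR.
Qed.

(** When [r < 1] the integrand is unbounded near [0], so for [v = 0] the
    fundamental theorem is applied on [[w / n.+2, w]] only, followed by monotone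
    convergence. *)
Lemma integral_powR (r v w : R) : 0 < r -> 0 <= v -> v <= w ->
  (\int[mu]_(t in `]v, w[) (r * t `^ (r - 1))%:E = (w `^ r - v `^ r)%:E)%E.
Proof.
move=> r0; rewrite le_eqVlt => /predU1P[<- w0|v0 vw]; last first.
  move: vw; rewrite le_eqVlt => /predU1P[<-|vw].
    by rewrite set_itvoo0 ?lexx// integral_set0 subrr.
  rewrite -(@integral_itv_bndoo _ _ _ _ true false) ?integral_powR_pos//.
  exact: measurable_powR_weight.
rewrite (powR0 (lt0r_neq0 r0)) subr0.
move: w0; rewrite le_eqVlt => /predU1P[<-|w0].
  by rewrite set_itvoo0 ?lexx// integral_set0 powR0// gt_eqF.
(* The offset [n.+2] keeps these segments nondegenerate. *)
pose F (n : nat) := `[w / n.+2%:R, w]%classic.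
have nd : nondecreasing_seq F.
  move=> m n mn; apply/subsetPset => t; rewrite /F /= !in_itv /= => /andP[mt ->].
  rewrite andbT (le_trans _ mt)// ler_pM2l// lef_pV2 ?posrE ?ltr0n//.
  by rewrite ler_nat !ltnS.
have FU : \bigcup_n F n = `]0, w]%classic.
  apply/seteqP; split => t.
    move=> [n _]; rewrite /F /= !in_itv /= => /andP[nt ->].
    by rewrite andbT (lt_le_trans _ nt)// divr_gt0// ltr0n.
  rewrite /= in_itv /= => /andP[t0 tw].
  exists (Num.truncn (w / t)) => //; rewrite /F /= in_itv /= tw andbT.
  rewrite ler_pdivrMr ?ltr0n// mulrC -ler_pdivrMr//.
  by rewrite (le_trans (ltW (truncnS_gt _)))// ler_nat.
have cvgF : (\int[mu]_(t in F n) (r * t `^ (r - 1))%:E @[n --> \oo] -->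
    \int[mu]_(t in \bigcup_n F n) (r * t `^ (r - 1))%:E)%E.
  apply: ge0_nondecreasing_set_cvg_integral => // [n|n|n t _].
  - exact: measurable_itv.
  - exact: measurable_powR_weight.
  - by rewrite lee_fin mulr_ge0 ?powR_ge0// ltW.
rewrite -(@integral_itv_bndoo _ _ _ _ false false) -?FU; last first.
  exact: measurable_powR_weight.
rewrite -(cvg_lim (@ereal_hausdorff R) cvgF).
apply: cvg_lim; first exact: ereal_hausdorff.
rewrite (_ : (fun n => _) = (fun n => (w `^ r - (w / n.+2%:R) `^ r)%:E)); last first.
  apply/funext => n; rewrite /F integral_powR_pos// ?divr_gt0 ?ltr0n//.
  by rewrite ltr_pdivrMr ?ltr0n// ltr_pMr// ltr1n.
apply: cvg_EFin; first exact: nearW.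
rewrite -[X in _ --> X]subr0; apply: cvgB; first exact: cvg_cst.
have /cvg_at_rightP := powR_cvg0 r0.
apply; split => [n|]; first by rewrite divr_gt0// ltr0n.
rewrite -(mulr0 w); apply: cvgM; first exact: cvg_cst.
have := @cvg_harmonic R; rewrite -(cvg_shiftS (@harmonic R)) => h.
exact: h.
Qed.

End lebesgue_integrals.

(** * The Gamma function and a Beta integral *)

Section gamma.
Context {R : realType}.
Notation mu := (@lebesgue_measure R).
Implicit Types alpha p v w : R.

(** Extended-valued, so that Tonelli's theorem can be applied to it before its
    finiteness is known; indeed finiteness is deduced from those identities. *)
Definition eGamma (alpha : R) : \bar R :=
  (\int[mu]_(u in `]0%R, +oo[) (expR (- u) * u `^ (alpha - 1))%:E)%E.

Lemma measurable_Gamma_integrand alpha (D : set R) :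
  measurable_fun D (fun u : R => (expR (- u) * u `^ (alpha - 1))%:E).
Proof.
apply: measurable_funTS; apply/measurable_EFinP; apply: measurable_funM.
  by apply: measurableT_comp => //; exact: measurableT_comp.
exact: measurable_powR.
Qed.

Lemma eGamma_ge0 alpha : (0 <= eGamma alpha)%E.
Proof. by apply: integral_ge0 => u _; rewrite lee_fin mulr_ge0// ?expR_ge0 ?powR_ge0. Qed.

Lemma measurable_expRN (D : set R) : measurable_fun D (fun u : R => expR (- u)).
Proof. by apply: measurable_funTS; apply: measurableT_comp => //; exact: measurableT_comp. Qed.

Lemma powR_lt_inv alpha v w : 0 < alpha -> 0 <= v -> 0 <= w ->
  (v `^ alpha < w) = (v < w `^ alpha^-1).
Proof.
move=> a0 v0 w0.
have wE : (w `^ alpha^-1) `^ alpha = w by rewrite -powRrM mulVf ?gt_eqF// powRr1.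
have vE : (v `^ alpha) `^ alpha^-1 = v by rewrite -powRrM mulfV ?gt_eqF// powRr1.
apply/idP/idP => h.
- rewrite -vE; apply: gt0_ltr_powR => //; rewrite ?invr_gt0// nnegrE ?powR_ge0//.
- by rewrite -wE; apply: gt0_ltr_powR => //; rewrite ?nnegrE ?powR_ge0.
Qed.

Lemma itv0y_gt v : 0 <= v ->
  `]0, +oo[ `&` [set w | v < w] = `]v, +oo[%classic :> set R.
Proof.
move=> v0; apply/seteqP; split => w /=; rewrite !in_itv /= !andbT.
  by case.
by move=> vw; split => //; exact: le_lt_trans vw.
Qed.

Lemma itv0y_powR_lt alpha w : 0 < alpha -> 0 < w ->
  `]0, +oo[ `&` [set v | v `^ alpha < w] = `]0, w `^ alpha^-1[%classic :> set R.
Proof.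
move=> a0 w0; apply/seteqP; split => v /=; rewrite !in_itv /= ?andbT.
  by case=> v0; rewrite powR_lt_inv ?(ltW v0) ?(ltW w0)// => ->; rewrite v0.
by move=> /andP[v0 vw]; split=> //; rewrite powR_lt_inv ?(ltW v0) ?(ltW w0).
Qed.

(** Write [w^alpha] as the integral of [alpha * v^(alpha - 1)] over [0 < v < w] and
    integrate [exp (- w)] first. *)
Lemma eGammaD1 alpha : 0 < alpha -> eGamma (alpha + 1) = (alpha%:E * eGamma alpha)%E.
Proof.
move=> a0.
transitivity (\int[mu]_(w in `]0%R, +oo[)
  \int[mu]_(v in `]0%R, +oo[ `&` [set v | (id v < w)%R])
    (expR (- w) * (alpha * v `^ (alpha - 1)))%:E)%E.
  apply: eq_integral => w; rewrite inE /= in_itv /= andbT => w0.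
  rewrite (_ : _ `&` _ = `]0, w[%classic); last first.
    by apply/seteqP; split => v /=; rewrite !in_itv /= andbT; [case=> -> ->|move/andP].
  under eq_integral do rewrite EFinM.
  rewrite ge0_integralZl_EFin ?expR_ge0//; first last.
  - exact: measurable_powR_weight.
  - by move=> v _; rewrite lee_fin mulr_ge0 ?powR_ge0 ?ltW.
  by rewrite integral_powR ?(ltW w0)// powR0 ?gt_eqF// subr0 addrK -EFinM.
rewrite -(@tonelli_epigraph R _ _ id
  (fun v w => expR (- w) * (alpha * v `^ (alpha - 1))))//.
- rewrite /eGamma -ge0_integralZl_EFin ?ltW//; first last.
  + exact: measurable_Gamma_integrand.
  + by move=> u _; rewrite lee_fin mulr_ge0 ?expR_ge0 ?powR_ge0.
  apply: eq_integral => v; rewrite inE /= in_itv /= andbT => v0.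
  rewrite itv0y_gt ?ltW//.
  under eq_integral do rewrite mulrC EFinM.
  have k0 : 0 <= alpha * v `^ (alpha - 1) by rewrite mulr_ge0 ?powR_ge0// ltW.
  rewrite ge0_integralZl_EFin//; last first.
    apply/measurable_EFinP; exact: measurable_expRN.
  by rewrite integral_expRN -!EFinM -mulrA (mulrC (v `^ _)).
- apply: measurable_funM.
    exact: (measurableT_comp (@measurable_expRN setT)).
  apply: measurable_funM => //.
  exact: (measurableT_comp (measurable_powR _)).
- by move=> v w _ _ _; rewrite !mulr_ge0 ?expR_ge0 ?powR_ge0 ?ltW.
Qed.

(** Layer cake: [exp (- v^alpha)] is the integral of [exp (- w)] over
    [w > v^alpha], and the section of that region at height [w] has length
    [w^(1 / alpha)]. *)
Lemma integral_expRN_powR alpha : 0 < alpha ->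
  (\int[mu]_(v in `]0%R, +oo[) (expR (- v `^ alpha))%:E = eGamma (1 + alpha^-1))%E.
Proof.
move=> a0.
transitivity (\int[mu]_(v in `]0%R, +oo[)
  \int[mu]_(w in `]0%R, +oo[ `&` [set w | (v `^ alpha < w)%R]) (expR (- w))%:E)%E.
  apply: eq_integral => v _.
  by rewrite itv0y_gt ?powR_ge0// integral_expRN.
rewrite (@tonelli_epigraph R _ _ (fun v => v `^ alpha) (fun v w => expR (- w)))//.
- apply: eq_integral => w; rewrite inE /= in_itv /= andbT => w0.
  rewrite itv0y_powR_lt// integral_cst//=.
  rewrite lebesgue_measure_itv /= lte_fin powR_gt0// oppr0 adde0 -EFinM.
  by rewrite addrAC subrr add0r.
- exact: (measurableT_comp (@measurable_expRN setT)).
Qed.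

Lemma integral_expRN_shift p c :
  (\int[mu]_(w in `]c, +oo[) (expR (- w) * (w - c) `^ p)%:E =
   (expR (- c))%:E * eGamma (1 + p))%E.
Proof.
rewrite [LHS](ge0_integral_affine c (oner_neq0 R)); first last.
- by move=> w _; rewrite lee_fin mulr_ge0 ?expR_ge0 ?powR_ge0.
- apply: measurable_funTS; apply/measurable_EFinP; apply: measurable_funM.
    exact: measurable_expRN.
  apply: (measurableT_comp (measurable_powR _)).
  exact: measurable_funB.
- exact: measurable_itv.
rewrite normr1 mul1e.
rewrite (_ : [set u | _] = `]0, +oo[%classic); last first.
  by apply/seteqP; split => u /=; rewrite !in_itv /= !andbT mul1r ltrDr.
rewrite /eGamma -ge0_integralZl_EFin ?expR_ge0//.
- apply: eq_integral => u _; rewrite -EFinM mul1r addrK opprD expRD.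
  by rewrite mulrCA mulrA (addrC 1) addrK.
- by move=> u _; rewrite lee_fin mulr_ge0 ?expR_ge0 ?powR_ge0.
- exact: measurable_Gamma_integrand.
Qed.

Lemma measurable_powR_onem alpha p (D : set R) :
  measurable_fun D (fun t : R => (1 - t `^ alpha) `^ p).
Proof.
apply: measurable_funTS; apply: (measurableT_comp (measurable_powR _)).
by apply: measurable_funB => //; exact: measurable_powR.
Qed.

(** Homogeneity: the substitution [v = w^(1 / alpha) * t] extracts the factor
    [w^p] from the integrand and [w^(1 / alpha)] from the measure. *)
Lemma integral_powR_scale alpha p w : 0 < alpha -> 0 < w ->
  (\int[mu]_(v in `]0%R, (w `^ alpha^-1)%R[) ((w - v `^ alpha) `^ p)%:E =
   (w `^ (p + alpha^-1))%:E * \int[mu]_(t in `]0%R, 1%R[) ((1 - t `^ alpha) `^ p)%:E)%E.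
Proof.
move=> a0 w0; have wa0 : 0 < w `^ alpha^-1 by exact: powR_gt0.
rewrite [LHS](ge0_integral_affine 0 (lt0r_neq0 wa0)); first last.
- by move=> v _; rewrite lee_fin powR_ge0.
- apply: measurable_funTS; apply/measurable_EFinP.
  apply: (measurableT_comp (measurable_powR _)).
  by apply: measurable_funB => //; exact: measurable_powR.
- exact: measurable_itv.
rewrite (gtr0_norm wa0).
have -> : [set u | `]0, w `^ alpha^-1[%classic (w `^ alpha^-1 * u + 0)] = `]0, 1[%classic.
  apply/seteqP; split => u /=; rewrite !in_itv /= addr0 pmulr_rgt0//;
  by rewrite gtr_pMr.
have -> : w `^ (p + alpha^-1) = w `^ alpha^-1 * w `^ p.
  by rewrite (addrC p) powRD// (gt_eqF w0) implybT.
rewrite EFinM -muleA; congr (_ * _)%E.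
rewrite -ge0_integralZl_EFin ?powR_ge0//.
- apply: eq_integral => t /[!inE] /= /[!in_itv] /= /andP[t0 t1].
  rewrite -EFinM addr0 powRM ?ltW// -powRrM mulVf ?gt_eqF// powRr1 ?ltW//.
  rewrite -powRM ?ltW//; first by rewrite mulrBr mulr1.
  by rewrite subr_gt0 powR_lt_inv ?powR1 ?(ltW t0).
- by move=> t _; rewrite lee_fin powR_ge0.
- apply/measurable_EFinP; exact: measurable_powR_onem.
Qed.

(** The Beta formula in the form needed for the weight [1 - t^alpha]. Both sides
    are the double integral of [exp (- w) * (w - v^alpha)^p] over [0 < v^alpha < w]:
    integrating first in [w] gives the left-hand side by translation, and first in
    [v] gives the right-hand side by homogeneity. *)
Lemma eGammaM alpha p : 0 < alpha ->
  (eGamma (1 + p) * eGamma (1 + alpha^-1) =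
   \int[mu]_(t in `]0%R, 1%R[) ((1 - t `^ alpha) `^ p)%:E *
   eGamma (1 + p + alpha^-1))%E.
Proof.
move=> a0; rewrite -integral_expRN_powR//.
rewrite -ge0_integralZl ?eGamma_ge0//; last first.
  apply: measurable_funTS; apply/measurable_EFinP.
  by apply: (measurableT_comp (@measurable_expRN setT)); exact: measurable_powR.
transitivity (\int[mu]_(v in `]0%R, +oo[)
  \int[mu]_(w in `]0%R, +oo[ `&` [set w | (v `^ alpha < w)%R])
    (expR (- w) * (w - v `^ alpha) `^ p)%:E)%E.
  apply: eq_integral => v _.
  by rewrite itv0y_gt ?powR_ge0// integral_expRN_shift muleC.
rewrite (@tonelli_epigraph R _ _ (fun v => v `^ alpha)
  (fun v w => expR (- w) * (w - v `^ alpha) `^ p))//; first last.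
- by move=> v w _ _ _; rewrite mulr_ge0 ?expR_ge0 ?powR_ge0.
- apply: measurable_funM.
    exact: (measurableT_comp (@measurable_expRN setT)).
  apply: (measurableT_comp (measurable_powR _)).
  by apply: measurable_funB => //; exact: (measurableT_comp (measurable_powR _)).
rewrite -ge0_integralZl; first last.
- by apply: integral_ge0 => t _; rewrite lee_fin powR_ge0.
- by move=> u _; rewrite lee_fin mulr_ge0 ?expR_ge0 ?powR_ge0.
- exact: measurable_Gamma_integrand.
- exact: measurable_itv.
apply: eq_integral => w; rewrite inE /= in_itv /= andbT => w0.
rewrite itv0y_powR_lt//.
under eq_integral do rewrite EFinM.
rewrite ge0_integralZl_EFin ?expR_ge0//; first last.
- apply: measurable_funTS; apply/measurable_EFinP.
  apply: (measurableT_comp (measurable_powR _)).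
  by apply: measurable_funB => //; exact: measurable_powR.
- by move=> v _; rewrite lee_fin powR_ge0.
rewrite integral_powR_scale// (_ : 1 + p + alpha^-1 - 1 = p + alpha^-1); last by ring.
by rewrite muleA muleC EFinM.
Qed.

Lemma eGamma1 : eGamma 1 = 1%:E.
Proof.
rewrite /eGamma subrr; under eq_integral do rewrite powRr0 mulr1.
by rewrite integral_expRN oppr0 expR0.
Qed.

Lemma eGamma_natS_lty (n : nat) : (eGamma n.+1%:R < +oo)%E.
Proof.
elim: n => [|n IHn]; first by rewrite eGamma1 ltry.
by rewrite -natr1 eGammaD1 ?ltr0n// lte_mul_pinfty// lee_fin.
Qed.

(** By [eGammaD1] it is enough to treat [alpha + 1 >= 1], where the integrand lies
    below the sum of those of [eGamma 1] and [eGamma n.+1] for an integer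
    [n >= alpha]. *)
Lemma eGamma_lty alpha : 0 < alpha -> (eGamma alpha < +oo)%E.
Proof.
move=> a0; suff : (eGamma (alpha + 1) < +oo)%E.
  rewrite eGammaD1//; have := eGamma_ge0 alpha.
  by case: eGamma => [r||]; rewrite ?ltry// gt0_muley ?lte_fin.
pose n := (Num.truncn alpha).+1.
have an : alpha <= n%:R by apply/ltW/truncnS_gt.
apply: (@le_lt_trans _ _ (eGamma 1 + eGamma n.+1%:R)%E); last first.
  by rewrite eGamma1 lte_add_pinfty ?ltry ?eGamma_natS_lty.
rewrite /eGamma -ge0_integralD//; first last.
- exact: measurable_Gamma_integrand.
- by move=> u _; rewrite lee_fin mulr_ge0 ?expR_ge0 ?powR_ge0.
- exact: measurable_Gamma_integrand.
- by move=> u _; rewrite lee_fin mulr_ge0 ?expR_ge0 ?powR_ge0.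
apply: ge0_le_integral => //.
- by move=> u _; rewrite lee_fin mulr_ge0 ?expR_ge0 ?powR_ge0.
- exact: measurable_Gamma_integrand.
- by apply: emeasurable_funD; exact: measurable_Gamma_integrand.
move=> u; rewrite /= in_itv /= andbT => u0.
rewrite -EFinD lee_fin -mulrDr ler_wpM2l ?expR_ge0//.
rewrite addrK subrr powRr0 -natr1 addrK.
have [u1|u1] := leP u 1.
  rewrite ler_wpDr ?powR_ge0// -[leRHS](powRr0 u).
  by apply: ger_powR; rewrite ?u0 ?u1 ?ltW.
by rewrite ler_wpDl// ler_powR// ltW.
Qed.

(** On [[1, 2]] the integrand is at least [exp (- 2) / 2], as [u^(alpha - 1)] is at
    least [u^-1] there. *)
Lemma eGamma_gt0 alpha : 0 < alpha -> (0 < eGamma alpha)%E.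
Proof.
move=> a0.
apply: (@lt_le_trans _ _ (\int[mu]_(u in `[1%R, 2%R]) (expR (- 2) / 2)%:E)%E).
  rewrite integral_cst//= lebesgue_measure_itv /= lte_fin ltr1n -EFinD -EFinM lte_fin.
  by rewrite !mulr_gt0 ?expR_gt0//; lra.
apply: (@le_trans _ _ (\int[mu]_(u in `[1%R, 2%R]) (expR (- u) * u `^ (alpha - 1))%:E)%E).
  apply: ge0_le_integral => //.
  - exact: measurable_Gamma_integrand.
  move=> u; rewrite /= in_itv /= => /andP[u1 u2].
  rewrite lee_fin ler_pM ?expR_ge0// ?ler_expR ?lerN2//.
  apply: (@le_trans _ _ (u `^ (- 1))).
    by rewrite powR_inv1 ?(le_trans ler01)// lef_pV2 ?posrE// (lt_le_trans ltr01).
  by rewrite ler_powR//; lra.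
apply: ge0_subset_integral => //.
- exact: measurable_Gamma_integrand.
- by move=> u _; rewrite lee_fin mulr_ge0 ?expR_ge0 ?powR_ge0.
- by move=> u /=; rewrite !in_itv /= => /andP[u1 _]; rewrite andbT (lt_le_trans ltr01).
Qed.

Lemma GammaE alpha : 0 < alpha -> eGamma alpha = (Gamma alpha)%:E.
Proof.
move=> a0; rewrite /Gamma /Rintegral fineK// ge0_fin_numE ?eGamma_ge0//.
exact: eGamma_lty.
Qed.

Lemma Gamma_gt0 alpha : 0 < alpha -> 0 < Gamma alpha.
Proof. by move=> a0; rewrite -lte_fin -GammaE// eGamma_gt0. Qed.

Lemma GammaD1 alpha : 0 < alpha -> Gamma (alpha + 1) = alpha * Gamma alpha.
Proof.
move=> a0; apply: EFin_inj.
by rewrite EFinM -!GammaE// ?addr_gt0// eGammaD1.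
Qed.

Lemma integral_powR_onem alpha p : 0 < alpha -> 0 < p ->
  (\int[mu]_(t in `]0%R, 1%R[) ((1 - t `^ alpha) `^ p)%:E =
   (Gamma (1 + p) * Gamma (1 + alpha^-1) / Gamma (1 + p + alpha^-1))%:E)%E.
Proof.
move=> a0 p0; have := eGammaM p a0.
have ai0 : 0 < alpha^-1 by rewrite invr_gt0.
have g0 : 0 < Gamma (1 + p + alpha^-1) by rewrite Gamma_gt0// !addr_gt0.
rewrite !GammaE ?addr_gt0// => h.
by rewrite EFinM EFinM h -muleA -EFinM mulfV ?mule1// gt_eqF.
Qed.

End gamma.

(** * Deviation of a function on the unit interval from its value at 0 *)

Section unit_interval.
Context {R : realType}.
Notation mu := (@lebesgue_measure R).

(** Hoelder's inequality on the whole line, applied to the extensions of [f] and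
    [g] by zero: positive powers preserve [0], so they commute with extending. *)
Lemma ge0_hoelder_integral (D : set R) (f g : R -> R) (p q : R) :
  measurable D -> measurable_fun D f -> measurable_fun D g ->
  (forall t, D t -> 0 <= f t) -> (forall t, D t -> 0 <= g t) ->
  0 < p -> 0 < q -> p^-1 + q^-1 = 1 ->
  (\int[mu]_(t in D) (f t * g t)%:E <=
   (\int[mu]_(t in D) (f t `^ p)%:E) `^ p^-1 *
   (\int[mu]_(t in D) (g t `^ q)%:E) `^ q^-1)%E.
Proof.
move=> mD mf mg f0 g0 p0 q0 pq.
have mfD : measurable_fun setT (f \_ D) by exact: (measurable_restrictT _ _).1.
have mgD : measurable_fun setT (g \_ D) by exact: (measurable_restrictT _ _).1.
have pw (h : R -> R) (r : R) : 0 < r -> (forall t, D t -> 0 <= h t) ->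
    (\int[mu]_t (`|((h \_ D) t)%:E| `^ r) = \int[mu]_(t in D) (h t `^ r)%:E)%E.
  move=> r0 h0; rewrite [RHS]integral_mkcond; apply: eq_integral => t _.
  rewrite !patchE; case: ifPn; last by rewrite /= normr0 powR0 ?gt_eqF.
  by rewrite inE => Dt /=; rewrite ger0_norm ?h0.
have := hoelder mu mfD mgD p0 q0 pq.
have NE (h : R -> R) (r : R) : 0 < r -> (forall t, D t -> 0 <= h t) ->
    (Lnorm mu r%:E (EFin \o (h \_ D)) =
     (\int[mu]_(t in D) (h t `^ r)%:E) `^ r^-1)%E.
  by move=> r0 h0; rewrite unlock (pw h r r0 h0).
rewrite Lnorm1 (NE f p p0 f0) (NE g q q0 g0) => h; apply: le_trans h.
rewrite [leLHS]integral_mkcond le_eqVlt; apply/orP; left; apply/eqP.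
apply: eq_integral => t _; rewrite /= !patchE; case: ifPn.
  by rewrite inE => Dt; rewrite ger0_norm// mulr_ge0 ?f0 ?g0.
by rewrite mulr0 normr0.
Qed.

(** A mean value inequality with a variable bound [k] on the derivative. As only [k]
    is integrated, the derivative of [phi] may be discontinuous: the primitive [K]
    of [k] has derivative [k] in the open interval, so [K + phi] and [K - phi] have
    nonnegative derivatives. *)
Lemma norm_increment_le_primitive (k phi : R -> R) :
  measurable_fun setT k ->
  (forall v : R, v \in `[0, 1] -> 0 <= k v) ->
  (exists C, forall v : R, v \in `[0, 1] -> k v <= C) ->
  (forall v : R, v \in `]0, 1[ -> {for v, continuous k}) ->
  {within `[0, 1], continuous phi} ->
  (forall v : R, v \in `]0, 1[ -> derivable phi v 1) ->
  (forall v : R, v \in `]0, 1[ -> `|derive1 phi v| <= k v) ->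
  exists K : R -> R, [/\ measurable_fun (`[0, 1] : set R) K,
    forall u : R, u \in `[0, 1] -> (\int[mu]_(v in `]0%R, u[) (k v)%:E = (K u)%:E)%E &
    forall u : R, u \in `[0, 1] -> `|phi u - phi 0| <= K u].
Proof.
move=> mk k0 [C kC] ck cphi dphi phik.
have ik : mu.-integrable `[0, 1] (EFin \o k).
  apply: measurable_bounded_integrable => //.
  - exact/compact_finite_measure/segment_compact.
  - exact: measurable_funTS.
  - exists C; split; first exact: num_real.
    move=> c Cc v v01 /=; rewrite ger0_norm ?k0//.
    by rewrite (le_trans (kC _ _))// ltW.
pose K u := parameterized_integral mu 0 u k.
have cK : {within `[0, 1], continuous K}.
  exact: parameterized_integral_continuous.
have iku u : u \in `[0, 1] -> mu.-integrable `[0, u] (EFin \o k).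
  rewrite in_itv /= => /andP[u0 u1]; apply: integrableS ik => //.
  exact: subset_itvl.
have dK v : v \in `]0, 1[ -> derivable K v 1 /\ derive1 K v = k v.
  move=> v01; have /[!in_itv] /= /andP[v0 v1] := v01.
  exact: (continuous_FTC1_closed v1 ik v0 (ck _ v01)).
have K0 : K 0 = 0 by rewrite /K /parameterized_integral set_itv1 Rintegral_set1.
exists K; split.
- by apply: subspace_continuous_measurable_fun => //; exact: cK.
- move=> u u01; rewrite /K /parameterized_integral /Rintegral.
  rewrite fineK; last by apply: integrable_fin_num => //; exact: iku.
  apply/esym/(@integral_itv_bndoo R 0 u (EFin \o k) true false).
  by apply/measurable_EFinP; exact: measurable_funTS.
move=> u u01; have /[!in_itv] /= /andP[u0 u1] := u01.
rewrite ler_norml; apply/andP; split.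
- have : (K \+ phi) 0 <= (K \+ phi) u.
    apply: (@ger0_derive1_le_cc _ (K \+ phi) 0 1) => //.
    + by move=> v v01; apply: derivableD; [exact: (dK v v01).1|exact: dphi].
    + move=> v v01; rewrite derive1E deriveD; [|exact: (dK v v01).1|exact: dphi].
      rewrite -!derive1E (dK v v01).2.
      by have := phik v v01; rewrite ler_norml => /andP[+ _]; lra.
    + by move=> z; apply: continuousD; [exact: cK|exact: cphi].
    + by rewrite in_itv /= lexx ler01.
  by rewrite /= K0; lra.
- have : (K \- phi) 0 <= (K \- phi) u.
    apply: (@ger0_derive1_le_cc _ (K \- phi) 0 1) => //.
    + by move=> v v01; apply: derivableB; [exact: (dK v v01).1|exact: dphi].
    + move=> v v01; rewrite derive1E deriveB; [|exact: (dK v v01).1|exact: dphi].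
      rewrite -!derive1E (dK v v01).2.
      by have := phik v v01; rewrite ler_norml => /andP[_]; lra.
    + by move=> z; apply: continuousB; [exact: cK|exact: cphi].
    + by rewrite in_itv /= lexx ler01.
  by rewrite /= K0; lra.
Qed.

(** After [norm_increment_le_primitive], exchange the integrals over [v < u]; the
    factor [1 - v^alpha] is the mass that the weight gives to [`]v, 1[]. *)
Lemma weighted_deviation_le (alpha : R) (k phi : R -> R) :
  0 < alpha ->
  measurable_fun setT k ->
  (forall v : R, v \in `[0, 1] -> 0 <= k v) ->
  (exists C, forall v : R, v \in `[0, 1] -> k v <= C) ->
  (forall v : R, v \in `]0, 1[ -> {for v, continuous k}) ->
  {within `[0, 1], continuous phi} ->
  (forall v : R, v \in `]0, 1[ -> derivable phi v 1) ->
  (forall v : R, v \in `]0, 1[ -> `|derive1 phi v| <= k v) ->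
  (\int[mu]_(u in `]0%R, 1%R[) (alpha * u `^ (alpha - 1) * `|phi u - phi 0|)%:E <=
   \int[mu]_(v in `]0%R, 1%R[) ((1 - v `^ alpha) * k v)%:E)%E.
Proof.
move=> a0 mk k0 bk ck cphi dphi phik.
have [K [mK KE phiK]] := norm_increment_le_primitive mk k0 bk ck cphi dphi phik.
have oc : (`]0, 1[%classic : set R) `<=` (`[0, 1]%classic : set R) by exact: subset_itv_oo_cc.
have w0 (u : R) : 0 <= alpha * u `^ (alpha - 1) by rewrite mulr_ge0 ?powR_ge0// ltW.
have mw : measurable_fun setT (fun u : R => alpha * u `^ (alpha - 1)).
  by apply/measurable_EFinP; exact: measurable_powR_weight.
apply: (@le_trans _ _
    (\int[mu]_(u in `]0%R, 1%R[) (alpha * u `^ (alpha - 1) * K u)%:E)%E).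
  apply: ge0_le_integral => //.
  - by move=> u _; rewrite lee_fin mulr_ge0.
  - apply/measurable_EFinP/measurable_funM; first exact: measurable_funTS.
    apply: measurableT_comp => //; apply: measurable_funB => //.
    apply: measurable_funS oc _ => //.
    exact: subspace_continuous_measurable_fun.
  - apply/measurable_EFinP/measurable_funM; first exact: measurable_funTS.
    exact: measurable_funS oc _.
  - by move=> u u01; rewrite lee_fin ler_wpM2l// phiK//; exact: oc.
rewrite le_eqVlt; apply/orP; left; apply/eqP.
transitivity (\int[mu]_(u in `]0%R, 1%R[)
    \int[mu]_(v in `]0%R, 1%R[ `&` [set v | (id v < u)%R])
      (k v * (alpha * u `^ (alpha - 1)))%:E)%E.
  apply: eq_integral => u /[!inE] u01.
  have := u01; rewrite /= in_itv /= => /andP[u0 u1].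
  rewrite (_ : _ `&` _ = `]0, u[%classic); last first.
    apply/seteqP; split => v /=; rewrite !in_itv /=.
      by case=> /andP[-> _] ->.
    by move=> /andP[-> vu]; rewrite (lt_trans vu).
  under [RHS]eq_integral do rewrite mulrC EFinM.
  rewrite ge0_integralZl_EFin//.
  - by rewrite KE ?EFinM//; exact: oc.
  - move=> v; rewrite /= in_itv /= => /andP[v0 vu]; rewrite lee_fin k0//.
    by rewrite in_itv /= (ltW v0) ltW// (lt_trans vu).
  - exact/measurable_EFinP/measurable_funTS.
rewrite -(@tonelli_epigraph R _ _ id
  (fun v u => k v * (alpha * u `^ (alpha - 1))))//; first last.
- by move=> v u v01 _ _; rewrite mulr_ge0// k0//; exact: oc.
- apply: measurable_funM; first exact: (measurableT_comp mk).
  exact: (measurableT_comp mw).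
apply: eq_integral => v /[!inE] v01.
have := v01; rewrite /= in_itv /= => /andP[v0 v1].
rewrite (_ : _ `&` _ = `]v, 1[%classic); last first.
  apply/seteqP; split => u /=; rewrite !in_itv /=.
    by case=> /andP[_ ->] ->.
  by move=> /andP[vu ->]; rewrite (lt_trans v0).
under eq_integral do rewrite EFinM.
rewrite ge0_integralZl_EFin//.
- by rewrite integral_powR ?(ltW v0) ?(ltW v1)// powR1 -EFinM mulrC.
- by move=> u _; rewrite lee_fin.
- exact: measurable_powR_weight.
- by rewrite k0//; exact: oc.
Qed.

End unit_interval.

(** * Domination by an s-convex interpolation *)

Section sconvex_domination.
Context {R : realType}.
Notation mu := (@lebesgue_measure R).

Lemma integral_sconvex_weight (A B s : R) : 0 <= A -> 0 <= B -> 0 < s ->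
  (\int[mu]_(v in `]0%R, 1%R[) (v `^ s * A + (1 - v) `^ s * B)%:E =
   ((A + B) / (s + 1))%:E)%E.
Proof.
move=> A0 B0 s0; have s10 : 0 < s + 1 by rewrite addr_gt0.
have ms (D : set R) : measurable_fun D (fun v : R => v `^ s).
  by apply: measurable_funTS; exact: measurable_powR.
have ms1 (D : set R) : measurable_fun D (fun v : R => (1 - v) `^ s).
  by apply: measurable_funTS; apply: (measurableT_comp (measurable_powR _));
    exact: measurable_funB.
have Is : (\int[mu]_(v in `]0%R, 1%R[) (v `^ s)%:E = ((s + 1)^-1)%:E)%E.
  have := @integral_powR R (s + 1) 0 1 s10 (lexx _) ler01.
  rewrite powR1 powR0 ?gt_eqF// subr0 addrK.
  under eq_integral do rewrite EFinM.
  rewrite ge0_integralZl_EFin ?(ltW s10)//; first last.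
  - by apply/measurable_EFinP; exact: ms.
  - by move=> v _; rewrite lee_fin powR_ge0.
  move=> /(congr1 (fun z => ((s + 1)^-1)%:E * z)%E).
  by rewrite muleA -EFinM mulVf ?gt_eqF// mul1e mule1.
have Is1 : (\int[mu]_(v in `]0%R, 1%R[) ((1 - v) `^ s)%:E = ((s + 1)^-1)%:E)%E.
  have m1 : (-1 : R) != 0 by rewrite oppr_eq0 oner_neq0.
  rewrite [LHS](ge0_integral_affine 1 m1); first last.
  - by move=> v _; rewrite lee_fin powR_ge0.
  - by apply/measurable_EFinP; exact: ms1.
  - exact: measurable_itv.
  rewrite normrN1 mul1e.
  have -> : [set u | `]0, 1[%classic (-1 * u + 1)] = `]0, 1[%classic :> set R.
    by apply/seteqP; split => u /=; rewrite !in_itv /= => /andP[? ?]; apply/andP; lra.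
  rewrite -Is; apply: eq_integral => v _; congr ((_ `^ s)%:E); ring.
under eq_integral do rewrite EFinD EFinM (EFinM ((1 - _) `^ s)).
rewrite ge0_integralD//; first last.
- by apply: emeasurable_funM => //; apply/measurable_EFinP; exact: ms1.
- by move=> v _; rewrite lee_fin mulr_ge0 ?powR_ge0.
- by apply: emeasurable_funM => //; apply/measurable_EFinP; exact: ms.
- by move=> v _; rewrite lee_fin mulr_ge0 ?powR_ge0.
rewrite !ge0_integralZr//; first last.
- by move=> v _; rewrite lee_fin powR_ge0.
- by apply/measurable_EFinP; exact: ms.
- by move=> v _; rewrite lee_fin powR_ge0.
- by apply/measurable_EFinP; exact: ms1.
by rewrite Is Is1 -!EFinM -EFinD mulrDl ![_^-1 * _]mulrC.
Qed.

(** Real powers take the value [1] at negative bases, so the outer one is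
    discontinuous at [0]; but its argument vanishes inside the open interval only
    if [A = B = 0], when the function is constant. *)
Lemma continuous_sconvex_weight (A B s r v : R) : 0 <= A -> 0 <= B -> 0 < r ->
  v \in `]0, 1[ ->
  {for v, continuous (fun v : R => (v `^ s * A + (1 - v) `^ s * B) `^ r)}.
Proof.
move=> A0 B0 r0 /[!in_itv] /= /andP[v0 v1].
have cpow (e t : R) : 0 < t -> {for t, continuous (fun t : R => t `^ e)}.
  move=> t0; apply: differentiable_continuous; apply/derivable1_diffP.
  by apply: derivable_powR; rewrite in_itv /= t0.
have [AB|AB] := eqVneq (A + B) 0.
  have [-> ->] : A = 0 /\ B = 0 by split; lra.
  rewrite (_ : (fun _ => _) = cst 0); first exact: cst_continuous.
  by apply/funext => t; rewrite !mulr0 addr0 powR0 ?gt_eqF.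
have h0 : 0 < v `^ s * A + (1 - v) `^ s * B.
  have V0 : 0 < v `^ s by exact: powR_gt0.
  have W0 : 0 < (1 - v) `^ s by apply: powR_gt0; lra.
  have [A1|A1] := eqVneq A 0.
    by rewrite A1 mulr0 add0r mulr_gt0// lt_def B0 andbT; move: AB; rewrite A1 add0r.
  by rewrite ltr_pwDl ?mulr_ge0 ?powR_ge0// mulr_gt0// lt_def A1.
apply: (@continuous_comp _ _ _ (fun v : R => v `^ s * A + (1 - v) `^ s * B)
  (fun t : R => t `^ r)); last exact: cpow.
apply: cvgD; apply: cvgM; [exact: cpow|exact: cvg_cst| |exact: cvg_cst].
apply: (@continuous_comp _ _ _ (fun v : R => 1 - v) (fun t : R => t `^ s)).
  by apply: cvgB; [exact: cvg_cst|exact: cvg_id].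
by apply: cpow; lra.
Qed.

(** [weighted_deviation_le] with [k = M * (v^s A + (1 - v)^s B)^(1/q)], followed by
    Hoelder's inequality, whose two factors are explicit integrals. *)
Lemma unit_deviation_bound (alpha p q s M A B : R) (phi : R -> R) :
  0 < alpha -> 0 < p -> 0 < q -> p^-1 + q^-1 = 1 -> 0 < s ->
  0 <= M -> 0 <= A -> 0 <= B ->
  {within `[0, 1], continuous phi} ->
  (forall v : R, v \in `]0, 1[ -> derivable phi v 1) ->
  (forall v : R, v \in `]0, 1[ ->
    `|derive1 phi v| <= M * (v `^ s * A + (1 - v) `^ s * B) `^ q^-1) ->
  (\int[mu]_(u in `]0%R, 1%R[) (alpha * u `^ (alpha - 1) * `|phi u - phi 0|)%:E <=
   ((Gamma (1 + p) * Gamma (1 + alpha^-1) / Gamma (1 + p + alpha^-1)) `^ p^-1 *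
    (M * ((A + B) / (s + 1)) `^ q^-1))%:E)%E.
Proof.
move=> a0 p0 q0 pq s0 M0 A0 B0 cphi dphi phik.
pose h (v : R) := v `^ s * A + (1 - v) `^ s * B.
have h0 v : 0 <= h v by rewrite addr_ge0// mulr_ge0// powR_ge0.
have mh : measurable_fun setT h.
  apply: measurable_funD; apply: measurable_funM => //.
  apply: (measurableT_comp (measurable_powR _)); exact: measurable_funB.
pose k v := M * h v `^ q^-1.
have k0 v : 0 <= k v by rewrite mulr_ge0 ?powR_ge0.
have mk : measurable_fun setT k.
  by apply: measurable_funM => //; exact: (measurableT_comp (measurable_powR _)).
apply: (le_trans (@weighted_deviation_le R alpha k phi a0 mk _ _ _ cphi dphi phik)).
- by move=> v _; exact: k0.
- exists (M * (A + B) `^ q^-1) => v /[!in_itv] /= /andP[v0 v1].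
  have le1 (t : R) : 0 <= t -> t <= 1 -> t `^ s <= 1.
    move=> t0 t1; apply: (@le_trans _ _ (1 `^ s)); last by rewrite powR1.
    by apply: ge0_ler_powR; rewrite ?nnegrE ?(ltW s0).
  have hAB : h v <= A + B by rewrite /h lerD// ler_piMl// le1//; lra.
  have qi0 : 0 <= q^-1 by rewrite invr_ge0 ltW.
  rewrite ler_wpM2l//; apply: ge0_ler_powR => //; rewrite nnegrE; first exact: h0.
  exact: addr_ge0.
- move=> v v01; apply: cvgM; first exact: cvg_cst.
  by apply: continuous_sconvex_weight => //; rewrite invr_gt0.
have onem v : v \in `]0, 1[ -> 0 <= 1 - v `^ alpha.
  move=> /[!in_itv] /= /andP[v0 v1]; rewrite subr_ge0 ltW//.
  by rewrite powR_lt_inv ?powR1 ?(ltW v0).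
apply: (le_trans (@ge0_hoelder_integral R _ (fun v => 1 - v `^ alpha) k p q
  _ _ _ _ _ p0 q0 pq)) => //.
- by apply: measurable_funTS; apply: measurable_funB => //; exact: measurable_powR.
- exact: measurable_funTS.
rewrite integral_powR_onem//.
have -> : (\int[mu]_(t in `]0%R, 1%R[) (k t `^ q)%:E =
    (M `^ q * ((A + B) / (s + 1)))%:E)%E.
  transitivity (\int[mu]_(t in `]0%R, 1%R[) ((M `^ q)%:E * (h t)%:E))%E.
    apply: eq_integral => v _.
    rewrite powRM ?powR_ge0// -powRrM mulVf ?gt_eqF// powRr1 ?h0// EFinM//.
  rewrite ge0_integralZl_EFin ?powR_ge0//.
  - by rewrite integral_sconvex_weight// EFinM.
  - by move=> v _; rewrite lee_fin.
  - by apply/measurable_EFinP; exact: measurable_funTS.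
have AB0 : 0 <= (A + B) / (s + 1) by rewrite divr_ge0 ?addr_ge0// ltW.
rewrite !poweR_EFin -EFinM lee_fin (@powRM _ (M `^ q)) ?powR_ge0//.
by rewrite -powRrM mulfV ?gt_eqF// powRr1.
Qed.

End sconvex_domination.

(** * Derivatives relative to an interval *)

Section relative_derivative.
Context {R : realType}.

(** At an interior point the relative punctured neighbourhoods are the usual ones;
    the two difference quotients then differ by the translation [h = z - y]. *)
Lemma derive_within_interior (I : set R) (f : R -> R) (y : R) :
  nbhs y I -> derivable f y 1 -> derive_within I f y = derive1 f y.
Proof.
move=> Iy df; rewrite /derive_within.
have -> : within I y^' = y^'.
  apply/funext => P; apply/propext; rewrite /within /=; split => H.
    near=> z; have : I z by near: z; apply: nbhs_dnbhs.
    by near: z.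
  by near=> z => _; near: z.
apply: cvg_lim; first exact: Rhausdorff.
have D : h^-1 *: (f (h *: 1 + y) - f y) @[h --> 0^'] --> derive1 f y.
  by rewrite derive1E; exact: df.
have sub0 : (z - y) @[z --> y^'] --> 0^'.
  have c0 : (z - y) @[z --> y] --> (0 : R).
    by rewrite -(subrr y); apply: cvgB; [exact: cvg_id|exact: cvg_cst].
  move=> B B0.
  have Hb : nbhs y (fun z => z - y != 0 -> B (z - y)) by exact: c0 _ B0.
  have : nbhs y (fun z => z != y -> B (z - y)).
    by apply: filterS Hb => z h zy; apply: h; rewrite subr_eq0.
  exact.
have := cvg_comp _ _ sub0 D; apply: cvg_trans; apply: near_eq_cvg.
apply: nearW => z; rewrite /= /GRing.scale /= mulr1 subrK mulrC //.
Unshelve. all: by end_near. Qed.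

(** The increment of [f] is the product of the difference quotient, which
    converges, with [z - y], which tends to [0]. *)
Lemma within_continuous_derivable_within (I : set R) (f : R -> R) (A : set R) :
  A `<=` I -> (forall y, A y -> derivable_within I f y) ->
  {within A, continuous f}.
Proof.
move=> AI dfA; apply/subspace_continuousP => y Ay.
have /cvg_ex[L Q] : cvg ((f z - f y) / (z - y) @[z --> within I y^']) by exact: dfA.
have Q' : (f z - f y) / (z - y) @[z --> within A y^'] --> L.
  apply: cvg_trans Q; apply: cvg_app; exact: within_subset.
have d0 : z - y @[z --> within A y^'] --> 0.
  rewrite -(subrr y); apply: cvgB; last exact: cvg_cst.
  by apply: cvg_within_filter; exact: nbhs_dnbhs.
have fy : f z @[z --> within A y^'] --> f y.
  have H : (f z - f y) / (z - y) * (z - y) + f y @[z --> within A y^'] --> f y.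
    rewrite -[X in _ --> X]add0r -(mulr0 L).
    by apply: cvgD; [exact: cvgM|exact: cvg_cst].
  apply: cvg_trans H; apply: near_eq_cvg.
  have ne : \forall z \near within A y^', z != y.
    have : nbhs y (fun z => z != y -> A z -> z != y) by apply: filterE => z.
    exact.
  near=> z; have zy : z != y by near: z.
  by rewrite /= mulfVK ?subrK// subr_eq0.
move=> B fB.
have H : nbhs y (fun z => z != y -> A z -> B (f z)) by exact: fy.
have : nbhs y (fun z => A z -> B (f z)).
  apply: filterS H => z h Az; have [->|zy] := eqVneq z y; first exact: nbhs_singleton.
  exact: h.
exact.
Unshelve. all: by end_near. Qed.

Lemma within_continuous_affine (m c : R) (J : set R) (f : R -> R) (D : set R) :
  (forall u, D u -> J (m * u + c)) -> {within J, continuous f} ->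
  {within D, continuous (fun u => f (m * u + c))}.
Proof.
move=> DJ /subspace_continuousP cf; apply/subspace_continuousP => u Du.
apply: (@cvg_comp _ _ _ (fun u => m * u + c) f _ (within J (nbhs (m * u + c)))); last exact/cf/DJ.
have ca : {for u, continuous (fun u => m * u + c)}.
  by apply: cvgD; [apply: cvgM; [exact: cvg_cst|exact: cvg_id]|exact: cvg_cst].
move=> B JB.
have H : nbhs u (fun v => J (m * v + c) -> B (m * v + c)) by exact: ca _ JB.
have : nbhs u (fun v => D v -> B (m * v + c)).
  by apply: filterS H => v h Dv; apply: h; exact: DJ.
exact.
Qed.

End relative_derivative.

(** * The half of the inequality attached to one endpoint *)

Section endpoint.
Context {R : realType}.
Notation mu := (@lebesgue_measure R).

(** The substitution [t = m * u + c] from [[0, 1]] onto the segment [J] between [c]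
    and [m + c]. Stating it through the preimage of [J] treats [c < m + c] and
    [m + c < c] at once. *)
Lemma weighted_integral_affine (alpha c m : R) (J : set R) (psi : R -> R) :
  0 < alpha -> m != 0 -> measurable J ->
  [set u | J (m * u + c)] = `[0, 1]%classic ->
  measurable_fun J psi -> (forall t, J t -> 0 <= psi t) ->
  (\int[mu]_(t in J) (alpha * `|t - c| `^ (alpha - 1) * psi t)%:E =
   (`|m| `^ alpha)%:E *
   \int[mu]_(u in `]0%R, 1%R[) (alpha * u `^ (alpha - 1) * psi (m * u + c)%R)%:E)%E.
Proof.
move=> a0 m0 mJ hJ mpsi psi0.
have J01 u : u \in `]0, 1[ -> J (m * u + c).
  move=> u01; suff : [set u | J (m * u + c)] u by [].
  by rewrite hJ; exact: subset_itv_oo_cc.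
rewrite [LHS](ge0_integral_affine c m0 mJ); first last.
- by move=> t Jt; rewrite lee_fin !mulr_ge0 ?powR_ge0 ?psi0 ?ltW.
- apply/measurable_EFinP; apply: measurable_funM => //; apply: measurable_funTS.
  apply: measurable_funM => //; apply: (measurableT_comp (measurable_powR _)).
  by apply: measurableT_comp => //; exact: measurable_funB.
rewrite hJ.
have mc (r : R) : measurable_fun (`]0, 1[%classic : set R)
    (fun u => (alpha * (r * u `^ (alpha - 1)) * psi (m * u + c))%:E).
  apply/measurable_EFinP; apply: measurable_funM.
    apply: measurable_funTS; apply: measurable_funM => //.
    by apply: measurable_funM => //; exact: measurable_powR.
  apply: (measurable_comp (F := J) mJ _ mpsi).
    by move=> _ [u u01 <-]; exact: J01.
  by apply: measurable_funTS; exact: measurable_affine.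
transitivity (`|m|%:E * \int[mu]_(u in `]0%R, 1%R[)
   (alpha * (`|m| `^ (alpha - 1) * u `^ (alpha - 1)) * psi (m * u + c)%R)%:E)%E.
  congr (_ * _)%E.
  have E u : u \in `]0, 1[ ->
      (alpha * `|m * u + c - c| `^ (alpha - 1) * psi (m * u + c))%:E =
      (alpha * (`|m| `^ (alpha - 1) * u `^ (alpha - 1)) * psi (m * u + c))%:E.
    move=> /[!in_itv] /= /andP[u0 u1].
    by rewrite addrK normrM (gtr0_norm u0) powRM// ltW.
  transitivity (\int[mu]_(u in `]0%R, 1%R[)
      (alpha * `|m * u + c - c| `^ (alpha - 1) * psi (m * u + c)%R)%:E)%E.
    apply: (@integral_itv_bndoo R 0 1 _ true false).
    apply: eq_measurable_fun (mc (`|m| `^ (alpha - 1))) => u /[!inE] u01.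
    by rewrite /= E.
  by apply: eq_integral => u /[!inE] u01; rewrite E.
rewrite -!ge0_integralZl_EFin ?powR_ge0//.
- apply: eq_integral => u _; rewrite -!EFinM -(mulr_powRB1 (normr_ge0 m) a0).
  by congr EFin; ring.
- move=> u u01; rewrite lee_fin !mulr_ge0 ?powR_ge0 ?psi0 ?ltW//; exact: J01.
- by apply: eq_measurable_fun (mc 1) => u _; rewrite mul1r.
- move=> u u01; rewrite lee_fin !mulr_ge0 ?powR_ge0 ?psi0 ?ltW//; exact: J01.
- exact: mc.
Qed.

(** The weight [w t = alpha * |t - c|^(alpha - 1)] has mass [|x - c|^alpha] on [J], so
    the quantity to bound is the integral of [w t * (f c - f t)]. Its absolute
    integrability, which allows splitting the integral, is part of the bound
    provided by [unit_deviation_bound]. *)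
Lemma endpoint_deviation_bound (alpha p q s c x A B : R) (J : set R) (f : R -> R) :
  0 < alpha -> 0 < p -> 0 < q -> p^-1 + q^-1 = 1 -> 0 < s ->
  0 <= A -> 0 <= B ->
  x - c != 0 -> measurable J ->
  [set u | J ((x - c) * u + c)] = `[0, 1]%classic ->
  {within J, continuous f} ->
  (forall u : R, u \in `]0, 1[ -> derivable f ((x - c) * u + c) 1) ->
  (forall u : R, u \in `]0, 1[ ->
    `|derive1 f ((x - c) * u + c)| <= (u `^ s * A + (1 - u) `^ s * B) `^ q^-1) ->
  `| `|x - c| `^ alpha * f c -
     alpha * \int[mu]_(t in J) (`|t - c| `^ (alpha - 1) * f t) | <=
  (Gamma (1 + p) * Gamma (1 + alpha^-1) / Gamma (1 + p + alpha^-1)) `^ p^-1 *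
  (`|x - c| `^ (alpha + 1) * ((A + B) / (s + 1)) `^ q^-1).
Proof.
move=> a0 p0 q0 pq s0 A0 B0 m0 mJ hJ cf df f'AB.
set m := x - c in m0 hJ df f'AB *.
have hJu u : J (m * u + c) <-> u \in `[0, 1].
  by rewrite -[J _]/([set u | J (m * u + c)] u) hJ.
pose phi u := f (m * u + c).
have phi0 : phi 0 = f c by rewrite /phi mulr0 add0r.
have cphi : {within `[0, 1], continuous phi}.
  by apply: (within_continuous_affine _ cf) => u u01; exact/hJu.
have daff (u : R) : is_derive u 1 (fun u : R => m * u + c) m.
  apply: is_derive_eq; rewrite /GRing.scale /=; ring.
have dphi (v : R) : v \in `]0, 1[ -> derivable phi v 1.
  move=> v01; apply/derivable1_diffP; apply: differentiable_comp.
    by apply/derivable1_diffP; exact: ex_derive.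
  by apply/derivable1_diffP; exact: df.
have d1phi (v : R) : v \in `]0, 1[ -> derive1 phi v = derive1 f (m * v + c) * m.
  move=> v01; rewrite [LHS](@derive1_comp _ (fun u => m * u + c) f)//; last exact: df.
  by congr (_ * _); rewrite derive1E; exact: derive_val.
have phiAB (v : R) : v \in `]0, 1[ ->
    `|derive1 phi v| <= `|m| * (v `^ s * A + (1 - v) `^ s * B) `^ q^-1.
  by move=> v01; rewrite d1phi// normrM mulrC ler_wpM2l// f'AB.
have bound := unit_deviation_bound a0 p0 q0 pq s0 (normr_ge0 m) A0 B0 cphi dphi phiAB.
set C := _ `^ p^-1 in bound *.
pose w t := alpha * `|t - c| `^ (alpha - 1).
have w0 t : 0 <= w t by rewrite mulr_ge0 ?powR_ge0 ?ltW.
have mw (D : set R) : measurable_fun D w.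
  apply: measurable_funTS; apply: measurable_funM => //.
  apply: (measurableT_comp (measurable_powR _)).
  by apply: measurableT_comp => //; exact: measurable_funB.
have mf : measurable_fun J f by exact: subspace_continuous_measurable_fun.
have mdev : measurable_fun J (fun t => f t - f c) by exact: measurable_funB.
have Iw : (\int[mu]_(t in J) (w t)%:E = (`|m| `^ alpha)%:E)%E.
  transitivity (\int[mu]_(t in J) (w t * cst 1 t)%:E)%E.
    by apply: eq_integral => t _; rewrite mulr1.
  rewrite (@weighted_integral_affine _ _ m J (cst 1))//.
  under eq_integral do rewrite mulr1.
  by rewrite integral_powR// powR1 powR0 ?gt_eqF// subr0 mule1.
have Idev : (\int[mu]_(t in J) (w t * `|f t - f c|)%:E <=
    (C * (`|m| `^ (alpha + 1) * ((A + B) / (s + 1)) `^ q^-1))%:E)%E.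
  rewrite (@weighted_integral_affine _ _ m J (fun t => `|f t - f c|))//; last exact: measurableT_comp.
  rewrite -phi0; apply: (le_trans (lee_wpmul2l _ bound)).
    by rewrite lee_fin powR_ge0.
  rewrite -EFinM lee_fin le_eqVlt; apply/orP; left; apply/eqP.
  by rewrite powRD ?normr_eq0 ?m0 ?implybT// powRr1//; ring.
have iw : mu.-integrable J (EFin \o w).
  apply/integrableP; split; first by apply/measurable_EFinP; exact: mw.
  under eq_integral do rewrite /= ger0_norm ?w0//.
  by rewrite Iw ltry.
have idev : mu.-integrable J (EFin \o (fun t => w t * (f t - f c))).
  apply/integrableP; split.
    apply/measurable_EFinP; apply: measurable_funM; [exact: mw|exact: mdev].
  apply: (le_lt_trans _ (ltry (C * (`|m| `^ (alpha + 1) * ((A + B) / (s + 1)) `^ q^-1)))).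
  apply: le_trans Idev; rewrite le_eqVlt; apply/orP; left; apply/eqP.
  by apply: eq_integral => t _; rewrite /= normrM (ger0_norm (w0 t)).
(* The measurable structure of the domain of [mu] is convertible to that of [R],
   but not syntactically equal to it. *)
have mJ' : measurable (J : set (measurableTypeR R)) := mJ.
have iwc : mu.-integrable J (EFin \o (fun t => w t * f c)).
  have := integrableZr mJ' (f c) iw.
  by apply: eq_integrable => // t _; rewrite /= EFinM.
have -> : alpha * (\int[mu]_(t in J) (`|t - c| `^ (alpha - 1) * f t)) =
    \int[mu]_(t in J) (w t * (f t - f c)) + `|m| `^ alpha * f c.
  have iwf : mu.-integrable J (EFin \o (fun t => w t * f t)).
    have := integrableD mJ' idev iwc.
    by apply: eq_integrable => // t _; rewrite /= -EFinD -mulrDr subrK.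
  have ivf : mu.-integrable J (EFin \o (fun t => `|t - c| `^ (alpha - 1) * f t)).
    have := integrableZl mJ' alpha^-1 iwf.
    apply: eq_integrable => // t _; rewrite /= -EFinM; congr EFin.
    by rewrite /w !mulrA mulVf ?gt_eqF// mul1r.
  rewrite -RintegralZl//.
  transitivity (\int[mu]_(t in J) (w t * (f t - f c) + w t * f c)).
    by apply: eq_Rintegral => t _; rewrite /w; ring.
  rewrite RintegralD//; congr (_ + _).
  rewrite RintegralZr//; congr (_ * _).
  by rewrite /Rintegral Iw.
rewrite opprD addrCA subrr addr0 normrN.
apply: (le_trans (le_normr_Rintegral mJ' idev)).
rewrite /Rintegral -lee_fin fineK.
  apply: le_trans Idev; rewrite le_eqVlt; apply/orP; left; apply/eqP.
  by apply: eq_integral => t _; rewrite /= normrM (ger0_norm (w0 t)).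
apply: integrable_fin_num => //.
by have := integrable_norm idev; apply: eq_integrable.
Qed.

End endpoint.

(** * The Hermite-Hadamard type inequality *)

Theorem theorem8 (R : realType) (I : set R) (f : R -> R)
    (a b p q alpha s x : R)
    (I_itv : is_interval I)
    (I_ge0 : I `<=` `[0, +oo[)
    (f_diff : forall y : R, (interior I) y -> derivable f y 1)
    (Ia : I a) (Ib : I b) (ab : a < b)
    (f'_exists : forall y : R, y \in `[a, b] -> derivable_within I f y)
    (f'_int : (@lebesgue_measure R).-integrable `[a, b]
                (fun y : R => (derive_within I f y)%:E))
    (p1 : 1 < p) (q1 : 1 < q) (pq : p^-1 + q^-1 = 1)
    (alpha0 : 0 < alpha)
    (s0 : 0 < s) (s1 : s <= 1)
    (f'_sconvex : sconvex_on s `[a, b]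
                    (fun y : R => `|derive_within I f y| `^ q))
    (xab : x \in `[a, b]) :
  `| ((x - a) `^ alpha * f a + (b - x) `^ alpha * f b) / (b - a)
     - Gamma (alpha + 1) / (b - a)
       * (RL_left x alpha f a + RL_right x alpha f b) |
  <= (Gamma (1 + p) * Gamma (1 + alpha^-1) / Gamma (1 + p + alpha^-1)) `^ p^-1
     * ((x - a) `^ (alpha + 1) / (b - a)
        * ((`|derive_within I f x| `^ q + `|derive_within I f a| `^ q)
             / (s + 1)) `^ q^-1
      + (b - x) `^ (alpha + 1) / (b - a)
        * ((`|derive_within I f x| `^ q + `|derive_within I f b| `^ q)
             / (s + 1)) `^ q^-1).
Proof.
have p0 : 0 < p by exact: lt_trans p1.
have q0 : 0 < q by exact: lt_trans q1.
have al0 : alpha != 0 by rewrite gt_eqF.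
have al10 : alpha + 1 != 0 by rewrite gt_eqF// addr_gt0.
have ba0 : b - a != 0 by rewrite subr_eq0 gt_eqF.
have abI y : y \in `[a, b] -> I y.
  by rewrite in_itv /= => yab; exact: (I_itv a b).
have ooI y : y \in `]a, b[ -> nbhs y I.
  move=> yab; apply: filterS (near_in_itvoo yab) => z zab.
  by apply: abI; exact: subset_itv_oo_cc.
have aab : a \in `[a, b] by rewrite in_itv /= lexx ltW.
have bab : b \in `[a, b] by rewrite in_itv /= lexx ltW.
have cf : {within `[a, b], continuous f}.
  by apply: (@within_continuous_derivable_within _ I) => // y; exact: abI.
pose g y := `|derive_within I f y| `^ q.
have half (c : R) (J : set R) : c \in `[a, b] -> x - c != 0 -> measurable J ->
    J `<=` `[a, b] -> [set u | J ((x - c) * u + c)] = `[0, 1]%classic ->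
    `| `|x - c| `^ alpha * f c -
       alpha * \int[@lebesgue_measure R]_(t in J) (`|t - c| `^ (alpha - 1) * f t) | <=
    (Gamma (1 + p) * Gamma (1 + alpha^-1) / Gamma (1 + p + alpha^-1)) `^ p^-1 *
    (`|x - c| `^ (alpha + 1) * ((g x + g c) / (s + 1)) `^ q^-1).
  move=> cab xc mJ Jab hJ.
  (* Two distinct points of [[a, b]] only have points of the open interval
     strictly between them, and there [f'] is an ordinary derivative. *)
  have inside (u : R) : u \in `]0, 1[ -> (x - c) * u + c \in `]a, b[.
    move: xab cab; rewrite !in_itv /= => /andP[ax xb] /andP[ac cb] /andP[u0 u1].
    move: xc; rewrite subr_eq0 neq_lt => /orP[xc|xc].
      have h1 : (x - c) * u < 0 by rewrite nmulr_rlt0// subr_lt0.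
      have h2 : 0 < (x - c) * (u - 1) by rewrite nmulr_rgt0 ?subr_lt0.
      by apply/andP; split; lra.
    have h1 : 0 < (x - c) * u by rewrite mulr_gt0// subr_gt0.
    have h2 : (x - c) * (u - 1) < 0 by rewrite pmulr_rlt0 ?subr_lt0 ?subr_gt0.
    by apply/andP; split; lra.
  have df (u : R) : u \in `]0, 1[ -> derivable f ((x - c) * u + c) 1.
    by move=> u01; apply: f_diff; exact/ooI/inside.
  apply: endpoint_deviation_bound => //.
  - exact: powR_ge0.
  - exact: powR_ge0.
  - exact: continuous_subspaceW cf.
  move=> u u01.
  rewrite -(derive_within_interior (ooI _ (inside _ u01)) (df _ u01)).
  move: (u01); rewrite in_itv /= => /andP[u0 u1].
  have H : g ((x - c) * u + c) <= u `^ s * g x + (1 - u) `^ s * g c.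
    rewrite (_ : (x - c) * u + c = u * x + (1 - u) * c); last by ring.
    apply: f'_sconvex => //; first exact: ltW.
      by rewrite subr_ge0 ltW.
    by rewrite addrC subrK.
  have -> : `|derive_within I f ((x - c) * u + c)| = g ((x - c) * u + c) `^ q^-1.
    by rewrite -powRrM mulfV ?gt_eqF// powRr1.
  apply: ge0_ler_powR; last exact: H.
  - by rewrite invr_ge0 ltW.
  - by rewrite nnegrE powR_ge0.
  - by rewrite nnegrE addr_ge0// mulr_ge0 ?powR_ge0.
have [ax xb] : a <= x /\ x <= b by move: xab; rewrite in_itv /= => /andP[].
set C := _ `^ p^-1 in half *.
have left : `|(x - a) `^ alpha * f a - alpha *
     \int[@lebesgue_measure R]_(t in `[a, x]) ((t - a) `^ (alpha - 1) * f t)| <=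
    C * ((x - a) `^ (alpha + 1) * ((g x + g a) / (s + 1)) `^ q^-1).
  have [->|xa] := eqVneq x a.
    rewrite set_itv1 Rintegral_set1 (subrr a) (powR0 al0) (powR0 al10).
    by rewrite !mul0r !mulr0 subr0 normr0.
  have xa0 : 0 < x - a by rewrite subr_gt0 lt_def xa.
  have := half a `[a, x]%classic aab (lt0r_neq0 xa0) (measurable_itv _).
  rewrite (gtr0_norm xa0).
  rewrite (_ : \int[_]_(t in _) _ = \int[@lebesgue_measure R]_(t in `[a, x])
      ((t - a) `^ (alpha - 1) * f t)); last first.
    apply: eq_Rintegral => t; rewrite inE /= in_itv /= => /andP[ta _].
    by rewrite ger0_norm ?subr_ge0.
  move=> H; apply: H; first exact: subset_itvl.
  apply/seteqP; split => u /=; rewrite !in_itv /= => /andP[h1 h2].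
    apply/andP; split.
      by rewrite -(pmulr_rge0 _ xa0); lra.
    by rewrite -(ler_pM2l xa0); lra.
  have k1 : 0 <= (x - a) * u by rewrite mulr_ge0// ltW.
  have k2 : (x - a) * u <= (x - a) * 1 by rewrite ler_pM2l.
  by apply/andP; split; lra.
have right : `|(b - x) `^ alpha * f b - alpha *
     \int[@lebesgue_measure R]_(t in `[x, b]) ((b - t) `^ (alpha - 1) * f t)| <=
    C * ((b - x) `^ (alpha + 1) * ((g x + g b) / (s + 1)) `^ q^-1).
  have [->|bx] := eqVneq x b.
    rewrite set_itv1 Rintegral_set1 (subrr b) (powR0 al0) (powR0 al10).
    by rewrite !mul0r !mulr0 subr0 normr0.
  have bx0 : 0 < b - x by rewrite subr_gt0 lt_def eq_sym bx.
  have xb0 : x - b != 0 by rewrite subr_eq0.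
  have := half b `[x, b]%classic bab xb0 (measurable_itv _).
  rewrite (distrC x b) (gtr0_norm bx0).
  rewrite (_ : \int[_]_(t in _) _ = \int[@lebesgue_measure R]_(t in `[x, b])
      ((b - t) `^ (alpha - 1) * f t)); last first.
    apply: eq_Rintegral => t; rewrite inE /= in_itv /= => /andP[_ tb].
    by rewrite (distrC t b) ger0_norm ?subr_ge0.
  move=> H; apply: H; first exact: subset_itvr.
  apply/seteqP; split => u /=; rewrite !in_itv /= => /andP[h1 h2].
    apply/andP; split.
      by rewrite -(pmulr_rge0 _ bx0); lra.
    by rewrite -(ler_pM2l bx0); lra.
  have k1 : 0 <= (b - x) * u by rewrite mulr_ge0// ltW.
  have k2 : (b - x) * u <= (b - x) * 1 by rewrite ler_pM2l.
  by apply/andP; split; lra.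
rewrite /RL_left /RL_right (GammaD1 alpha0).
have Ga0 : Gamma alpha != 0 by rewrite gt_eqF// Gamma_gt0.
have combine (P1 P2 I1 I2 L1 L2 Q1 Q2 : R) :
    `|P1 - alpha * I1| <= C * (L1 * Q1) -> `|P2 - alpha * I2| <= C * (L2 * Q2) ->
    `|(P1 + P2) / (b - a) - alpha * Gamma alpha / (b - a) *
       ((Gamma alpha)^-1 * I1 + (Gamma alpha)^-1 * I2)| <=
    C * (L1 / (b - a) * Q1 + L2 / (b - a) * Q2).
  move=> h1 h2.
  have -> : (P1 + P2) / (b - a) - alpha * Gamma alpha / (b - a) *
       ((Gamma alpha)^-1 * I1 + (Gamma alpha)^-1 * I2) =
      ((P1 - alpha * I1) + (P2 - alpha * I2)) / (b - a).
    by field; rewrite ba0 Ga0.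
  have -> : C * (L1 / (b - a) * Q1 + L2 / (b - a) * Q2) =
      (C * (L1 * Q1) + C * (L2 * Q2)) / (b - a) by field.
  rewrite normrM (@ger0_norm _ (b - a)^-1); last by rewrite invr_ge0 subr_ge0 ltW.
  rewrite ler_pM2r ?invr_gt0 ?subr_gt0//.
  by apply: (le_trans (ler_normD _ _)); exact: lerD.
exact: combine left right.
Qed.
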